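(* Let $\{g_k\}_{k\ge -1}$ be a BB1 gradient tail satisfying the post-warm-up convention (as defined in the context) with finite spectral set $\Lambda$. Then there exist constants $C_\Lambda<\infty$ and $\rho_\Lambda\in(0,1)$, depending only on $\Lambda$, such that $$\|g_k\|\le C_\Lambda\,\rho_\Lambda^{\,k}\,\|g_0\|\qquad(k\ge 0).$$ Consequently, the errors converge $R$-linearly with factor $\rho_\Lambda$ (i.e. there is a constant $C'<\infty$ with $\|x_k-x_*\|\le C'\rho_\Lambda^{\,k}$ for all $k\ge0$), and the objective gaps converge $R$-linearly with factor $\rho_\Lambda^2$ (i.e. there is a constant $C''<\infty$ with $f(x_k)-f(x_* )\le C''\rho_\Lambda^{\,2k}$ for all $k\ge 0$).
   Context: Setting. $H\in\mathbb{R}^{d\times d}$ is symmetric positive definite, $q\in\mathbb{R}^d$, $f(x)=\frac12 x^{\mathsf T}Hx-q^{\mathsf T}x$, $x_*=H^{-1}q$, and $g(x)=\nabla f(x)=H(x-x_* )$. $\|\cdot\|$ is the Euclidean norm. For $\lambda\in\operatorname{spec}(H)$, $P_\lambda$ is the orthogonal projector onto the eigenspace of $\lambda$. For a nonzero vector $v$, $\Lambda(v)=\{\lambda\in\operatorname{spec}(H):P_\lambda v\neq 0\}$. BB1 gradient tail satisfying the post-warm-up convention. A sequence $\{x_k\}_{k\ge -1}$ with $g_k=g(x_k)$ such that: $x_0=x_{-1}-\hat\alpha g_{-1}$ for some real $\hat\alpha$ (the warm-up step), so $g_0=(I-\hat\alpha H)g_{-1}$; the set $\Lambda:=\Lambda(g_{-1})$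 has $|\Lambda|\ge 2$; with $a:=\min\Lambda$ and $b:=\max\Lambda$ one has $P_ag_j\neq 0$ and $P_bg_j\ne 0$ for $j=-1,0$; and for every $k\ge 0$, $x_{k+1}=x_k-\alpha_kg_k$, so $g_{k+1}=(I-\alpha_kH)g_k$, with the BB1 step $$\alpha_k=\frac{g_{k-1}^{\mathsf T}g_{k-1}}{g_{k-1}^{\mathsf T}Hg_{k-1}}.$$ *)

(* Defs.v *)
From mathcomp Require Import all_boot all_order all_algebra.
From mathcomp Require Import all_classical all_reals.

Set Implicit Arguments.
Unset Strict Implicit.
Unset Printing Implicit Defensive.

Import Order.TTheory GRing.Theory Num.Theory.

Local Open Scope classical_set_scope.
Local Open Scope card_scope.
Local Open Scope ring_scope.

Definition dot (R : realType) (d : nat) (u v : 'cV[R]_d) : R :=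
  (u^T *m v) 0 0.

(* MathComp-Analysis equips matrices with the sup norm [`|_|]; this is the
   Euclidean one. *)
Definition enorm (R : realType) (d : nat) (v : 'cV[R]_d) : R :=
  Num.sqrt (dot v v).

Definition spd (R : realType) (d : nat) (H : 'M[R]_d) : Prop :=
  H^T = H /\ forall v : 'cV[R]_d, v != 0 -> 0 < dot v (H *m v).

Definition quad (R : realType) (d : nat) (H : 'M[R]_d) (q x : 'cV[R]_d) : R :=
  2^-1 * dot x (H *m x) - dot q x.

Definition xstar (R : realType) (d : nat) (H : 'M[R]_d) (q : 'cV[R]_d) :
  'cV[R]_d := invmx H *m q.

(* The gradient of [quad H q] at [x], for [H] symmetric and invertible. *)
Definition grad (R : realType) (d : nat) (H : 'M[R]_d) (q x : 'cV[R]_d) :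
  'cV[R]_d := H *m (x - xstar H q).

(* MathComp's eigenspaces and projectors act on row vectors. [proj_mx E F]
   projects onto the row space of [E] parallel to that of [F]; the rows of
   [kermx E^T] span the orthogonal complement of the row space of [E]. For
   symmetric [H] the row and column eigenspaces coincide up to transposition,
   and the outer transpose makes the projector act on columns. *)
Definition eigproj (R : realType) (d : nat) (H : 'M[R]_d) (lam : R) : 'M[R]_d :=
  (proj_mx (eigenspace H lam) (kermx (eigenspace H lam)^T))^T.

Definition spectral_set (R : realType) (d : nat) (H : 'M[R]_d) (v : 'cV[R]_d) :
  set R := [set lam | eigenvalue H lam /\ eigproj H lam *m v != 0].

Definition is_min (R : realType) (A : set R) (a : R) : Prop :=
  A a /\ lbound A a.

Definition is_max (R : realType) (A : set R) (b : R) : Prop :=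
  A b /\ ubound A b.

(* The BB1 step length computed from the previous gradient [g]. *)
Definition bb1_step (R : realType) (d : nat) (H : 'M[R]_d) (g : 'cV[R]_d) : R :=
  dot g g / dot g (H *m g).

(* The iterates [x_k], [k >= -1], are indexed by [int]; the values of [x] at
   indices below [-1] play no role. *)
Definition bb1_tail (R : realType) (d : nat) (H : 'M[R]_d) (q : 'cV[R]_d)
    (x : int -> 'cV[R]_d) : Prop :=
  let g (k : int) := grad H q (x k) in
  let Lam := spectral_set H (g (-1)) in
  [/\ exists ahat : R, x 0 = x (-1) - ahat *: g (-1),
      `I_2 #<= Lam,
      exists a b : R,
        [/\ is_min Lam a, is_max Lam b,
            eigproj H a *m g (-1) != 0 /\ eigproj H a *m g 0 != 0 &
            eigproj H b *m g (-1) != 0 /\ eigproj H b *m g 0 != 0] &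
      forall k : nat,
        x (k%:Z + 1) = x k%:Z - bb1_step H (g (k%:Z - 1)) *: g k%:Z].

(* Main.v *)
(** Expand the gradients in the eigenvectors [P_lam g_(-1)], [lam] in [Lam]: the
    energy of component [i] is multiplied by [(1 - alpha_k lam_i)^2] at step [k],
    hence by at most a fixed [K]. As [1 / alpha_(k+1)] is the average of the
    [lam_i] weighted by the energies at step [k], a component whose energy
    dominates the total energy of those with smaller eigenvalues makes
    [alpha_(k+1) lam_i <= 3/2] and so is contracted by a fixed factor at step
    [k+1]. Hence, from the lowest eigenvalue upwards, each component becomes
    negligible relative to the initial energy after a number of steps depending
    only on [Lam]. The total energy is thus divided by 4 over any window of some
    fixed length [m]. *)

Require Import Defs.
From mathcomp Require Import all_boot all_order all_algebra.
From mathcomp Require Import all_classical all_reals.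
From mathcomp Require Import complex ring lra zify.

Set Implicit Arguments.
Unset Strict Implicit.
Unset Printing Implicit Defensive.

Import Order.TTheory GRing.Theory Num.Theory.

Local Open Scope classical_set_scope.
Local Open Scope ring_scope.

(** * Diagonalization of real symmetric matrices *)

(* Over [R[i]] the minimal polynomial of [H] has simple roots, and they are
   real, so it already splits over [R]. *)
Lemma symmetric_diagonalizable (R : realType) (d : nat) (H : 'M[R]_d) :
  H^T = H -> diagonalizable H.
Proof.
case: d H => [|d] H Hsym; first by rewrite (flatmx0 H); exact: diagonalizable0.
pose rc := real_complex R : {rmorphism R -> R[i]}.
pose A := map_mx rc H.
have Aherm : A \is hermsymmx.
  apply: realsym_hermsym.
    by apply/is_hermitianmxP; rewrite expr0 scale1r map_mx_id // /A map_trmx Hsym.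
  by apply/mxOverP => i j; rewrite mxE /= complex_real.
have Asp := orthomx_spectralP (hermitian_normalmx Aherm).
have /mxOverP Dreal := hermitian_spectral_diag_real Aherm.
set u := undup [seq spectral_diag A 0 i | i <- enum 'I_d.+1].
have minA : mxminpoly A = \prod_(r <- u) ('X - r%:P).
  rewrite Asp -conjVmx ?spectral_unit// mxminpoly_uconj ?unitmx_inv ?spectral_unit//.
  exact: mxminpoly_diag.
have ureal : [seq rc (complex.Re z) | z <- u] = u.
  rewrite -[RHS]map_id; apply/eq_in_map => z.
  by rewrite mem_undup => /mapP[i _ ->]; exact: RRe_real.
apply/diagonalizableP; exists [seq complex.Re z | z <- u].
  rewrite -(map_inj_uniq (fmorph_inj rc)) -map_comp.
  by move: ureal => /= ->; exact: undup_uniq.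
(* The field embedding [rc] reflects divisibility and carries the minimal polynomial of [H] to that
   of [A]. *)
rewrite -(dvdp_map rc) -mxminpoly_map -/A minA -{1}ureal !big_map.
rewrite rmorph_prod /=.
by under [X in _ %| X]eq_bigr do rewrite map_polyXsubC; exact: dvdpp.
Qed.

(** * The Euclidean inner product *)

Lemma dotE (R : realType) (d : nat) (u v : 'cV[R]_d) :
  dot u v = \sum_i u i 0 * v i 0.
Proof. by rewrite /dot mxE; apply: eq_bigr => i _; rewrite mxE. Qed.

Lemma dotC (R : realType) (d : nat) (u v : 'cV[R]_d) : dot u v = dot v u.
Proof. by rewrite !dotE; apply: eq_bigr => i _; rewrite mulrC. Qed.

Lemma dotZr (R : realType) (d : nat) (c : R) (u v : 'cV[R]_d) :
  dot u (c *: v) = c * dot u v.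
Proof. by rewrite /dot -scalemxAr mxE. Qed.

Lemma dotZl (R : realType) (d : nat) (c : R) (u v : 'cV[R]_d) :
  dot (c *: u) v = c * dot u v.
Proof. by rewrite dotC dotZr dotC. Qed.

Lemma dotBr (R : realType) (d : nat) (u v w : 'cV[R]_d) :
  dot u (v - w) = dot u v - dot u w.
Proof. by rewrite /dot mulmxBr !mxE. Qed.

Lemma dot_sumr (R : realType) (d : nat) (I : Type) (r : seq I) (P : pred I)
    (u : 'cV[R]_d) (F : I -> 'cV[R]_d) :
  dot u (\sum_(i <- r | P i) F i) = \sum_(i <- r | P i) dot u (F i).
Proof. by rewrite /dot mulmx_sumr summxE. Qed.

Lemma dot_ge0 (R : realType) (d : nat) (u : 'cV[R]_d) : 0 <= dot u u.
Proof. by rewrite dotE; apply: sumr_ge0 => i _; exact: sqr_ge0. Qed.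

Lemma dot_eq0 (R : realType) (d : nat) (u : 'cV[R]_d) : dot u u = 0 -> u = 0.
Proof.
rewrite dotE => /psumr_eq0P u0; apply/colP => i; rewrite mxE.
have /eqP := u0 (fun i _ => sqr_ge0 (u i 0)) i isT.
by rewrite mulf_eq0 orbb => /eqP.
Qed.

Lemma dot_mulmx (R : realType) (d : nat) (H : 'M[R]_d) (u v : 'cV[R]_d) :
  H^T = H -> dot u (H *m v) = dot (H *m u) v.
Proof. by move=> Hsym; rewrite /dot trmx_mul Hsym mulmxA. Qed.

Lemma dot_eigen0 (R : realType) (d : nat) (H : 'M[R]_d) (l m : R)
    (u v : 'cV[R]_d) :
  H^T = H -> H *m u = l *: u -> H *m v = m *: v -> l != m -> dot u v = 0.
Proof.
move=> Hsym Hu Hv /negPf nlm; have := dot_mulmx u v Hsym.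
rewrite Hu Hv dotZl dotZr => /eqP; rewrite -subr_eq0 -mulrBl mulf_eq0 subr_eq0.
by rewrite eq_sym nlm => /eqP.
Qed.

(** * Orthogonal eigenprojectors and the spectral decomposition of a vector *)

Lemma mulmx_tr_eq0 (R : realType) (m n : nat) (W : 'M[R]_(m, n)) :
  W *m W^T = 0 -> W = 0.
Proof.
move=> W0; apply/row_matrixP => i; rewrite row0; apply: trmx_inj; rewrite trmx0.
apply: dot_eq0; rewrite dotE.
have /matrixP/(_ i i) := W0; rewrite !mxE => WW0; rewrite -[RHS]WW0.
by apply: eq_bigr => k _; rewrite !mxE.
Qed.

(** The rows of the intersection [W] are combinations of the rows of [E] and orthogonal to all of
    them, so [W *m W^T = 0]. *)
Lemma capmx_orthocomp (R : realType) (d : nat) (E : 'M[R]_d) :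
  (E :&: kermx E^T)%MS = 0.
Proof.
apply: mulmx_tr_eq0; have /submxP[D WE] := capmxSl E (kermx E^T).
rewrite {2}WE trmx_mul mulmxA.
by have /sub_kermxP -> := capmxSr E (kermx E^T); rewrite mul0mx.
Qed.

Lemma addsmx_orthocomp (R : realType) (d : nat) (E : 'M[R]_d) :
  row_full (E + kermx E^T)%MS.
Proof.
rewrite /row_full mxrank_disjoint_sum ?capmx_orthocomp// mxrank_ker mxrank_tr.
by rewrite subnKC// rank_leq_row.
Qed.

Lemma eigproj_eigen (R : realType) (d : nat) (H : 'M[R]_d) (l : R)
    (v : 'cV[R]_d) :
  H^T = H -> H *m (eigproj H l *m v) = l *: (eigproj H l *m v).
Proof.
move=> Hsym; apply: trmx_inj; rewrite linearZ /= trmx_mul Hsym.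
by apply/eigenspaceP; rewrite /eigproj trmx_mul trmxK proj_mx_sub.
Qed.

Lemma eigproj_compl (R : realType) (d : nat) (H : 'M[R]_d) (l : R)
    (v : 'cV[R]_d) :
  eigenspace H l *m (v - eigproj H l *m v) = 0.
Proof.
set E := eigenspace H l; apply: trmx_inj; rewrite trmx_mul trmx0.
apply/sub_kermxP; rewrite linearB /= trmx_mul trmxK.
by apply: proj_mx_compl_sub; apply: submx_full; exact: addsmx_orthocomp.
Qed.

Lemma trmx_eigenspace (R : realType) (d : nat) (H : 'M[R]_d) (l : R)
    (u : 'cV[R]_d) :
  H^T = H -> H *m u = l *: u -> (u^T <= eigenspace H l)%MS.
Proof.
by move=> Hsym Hu; apply/eigenspaceP; rewrite -{1}Hsym -trmx_mul Hu linearZ.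
Qed.

Lemma dot_eigproj (R : realType) (d : nat) (H : 'M[R]_d) (l : R)
    (u v : 'cV[R]_d) :
  H^T = H -> H *m u = l *: u -> dot u (v - eigproj H l *m v) = 0.
Proof.
move=> Hsym /(trmx_eigenspace Hsym)/submxP[D uE].
by rewrite /dot uE -mulmxA eigproj_compl mulmx0 mxE.
Qed.

(** The eigenspaces of a diagonalizable matrix span the whole space, and the residual of [v] is
    orthogonal to each of them, hence zero. *)
Lemma sum_eigproj (R : realType) (d : nat) (H : 'M[R]_d) :
  H^T = H -> exists2 rs : seq R, uniq rs &
    forall v : 'cV[R]_d, v = \sum_(r <- rs) eigproj H r *m v.
Proof.
move=> Hsym; have /diagonalizablePeigen[rs urs rsP] := symmetric_diagonalizable Hsym.
exists rs => // v; apply/eqP; rewrite -subr_eq0; apply/eqP.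
set y := v - _.
have Ey l : l \in rs -> eigenspace H l *m y = 0.
  move=> lrs; apply/row_matrixP => i; rewrite row_mul row0.
  have /eigenspaceP eH : (row i (eigenspace H l) <= eigenspace H l)%MS.
    exact: row_sub.
  set e := row i _ in eH *.
  have He : H *m e^T = l *: e^T by rewrite -[H]Hsym -trmx_mul eH linearZ.
  apply/matrixP => a b; rewrite !ord1 [RHS]mxE.
  have -> : (e *m y) 0 0 = dot e^T y by rewrite /dot trmxK.
  rewrite /y (bigD1_seq l)//= opprD addrA dotBr.
  rewrite dot_eigproj// sub0r dot_sumr big1 ?oppr0// => r rl.
  by apply: (dot_eigen0 Hsym He (eigproj_eigen _ _ Hsym)); rewrite eq_sym.
suff /sub_kermxP : (1%:M <= kermx y)%MS by rewrite mul1mx.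
rewrite -rsP big_seq.
by apply: (big_ind (fun A : 'M_d => (A <= kermx y)%MS)) => [|A B ? ?|l lrs];
  rewrite ?sub0mx ?addsmx_sub//; [apply/andP | apply/sub_kermxP; exact: Ey].
Qed.

(** In the expansion over all of [rs], the terms with index outside [s] vanish. Conversely [s] lies
    in [rs]: a component with eigenvalue outside [rs] is orthogonal to every term of its own
    expansion. *)
Lemma spectral_decomposition (R : realType) (d : nat) (H : 'M[R]_d)
    (v : 'cV[R]_d) (s : seq R) :
  H^T = H -> uniq s -> spectral_set H v = [set` s]%classic ->
  v = \sum_(l <- s) eigproj H l *m v.
Proof.
move=> Hsym us vs; have [rs urs rsv] := sum_eigproj Hsym.
have insP l : (l \in s) = (eigproj H l *m v != 0).
  apply/idP/idP => [ls|Pv0].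
    by have : [set` s]%classic l by []; rewrite -vs => -[].
  suff : spectral_set H v l by rewrite vs.
  split=> //; apply/eigenvalueP; exists (eigproj H l *m v)^T.
    exact/eigenspaceP/(trmx_eigenspace Hsym)/eigproj_eigen.
  by rewrite -trmx0 (inj_eq (@trmx_inj _ _ _)).
have srs : {subset s <= rs}.
  move=> l; rewrite insP; apply: contraR => lrs; apply/eqP/dot_eq0.
  set w := _ *m v; rewrite {2}(rsv w) dot_sumr big_seq big1// => r rrs.
  apply: (dot_eigen0 Hsym (eigproj_eigen _ _ Hsym) (eigproj_eigen _ _ Hsym)).
  by apply: contraNneq lrs => ->.
rewrite {1}(rsv v) (bigID (mem s))/= [X in _ + X]big1 ?addr0; last first.
  by move=> l; rewrite insP negbK => /eqP.
rewrite -big_filter; apply: perm_big; apply: uniq_perm => //.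
  exact: filter_uniq.
by move=> l; rewrite mem_filter andb_idr//; exact: srs.
Qed.

(** * Estimates for real sequences *)

(** A Bernoulli-type bound gives [t ^+ r <= 1 / (1 + r (1 - t))], and the Archimedean property
    supplies [r]. *)
Lemma exists_expr_le (R : realType) (t eps : R) :
  0 <= t < 1 -> 0 < eps -> exists r : nat, t ^+ r <= eps.
Proof.
move=> /andP[t0 t1] eps0.
have tr r : t ^+ r * (1 + r%:R * (1 - t)) <= 1.
  elim: r => [|r]; first by rewrite expr0 mul0r addr0 mulr1.
  apply: le_trans; rewrite exprSr -mulrA ler_wpM2l ?exprn_ge0//.
  have := ler0n R r; rewrite -natr1; set x := r%:R => x0.
  by have := mulr_ge0 (addr_ge0 x0 ler01) (sqr_ge0 (1 - t)); lra.
have d0 : 0 < eps * (1 - t) by rewrite mulr_gt0// subr_gt0.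
have di : 0 <= (eps * (1 - t))^-1 by rewrite invr_ge0 ltW.
exists (Num.bound (eps * (1 - t))^-1); have := archi_boundP di.
set r := Num.bound _; rewrite -div1r ltr_pdivrMr// => rlt.
have := tr r; have := exprn_ge0 r t0; nra.
Qed.

(* The contraction lags one step behind the test [c < y n], so after falling
   below [c] the sequence may grow by [K] twice. *)
Lemma eventually_le (R : realType) (K t c M : R) (m r : nat) (y : nat -> R) :
  1 <= K -> 0 <= t <= 1 -> t ^+ r * (K ^+ m.+1 * M) <= c ->
  (forall n, 0 <= y n) -> y 0%N <= M -> (forall n, y n.+1 <= K * y n) ->
  (forall n, (m <= n)%N -> c < y n -> y n.+2 <= t * y n.+1) ->
  forall n, (m.+1 + r <= n)%N -> y n <= K ^+ 2 * c.
Proof.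
move=> K1 /andP[t0 t1] rc y0 yM yK yt.
have K0 : 0 <= K by lra.
have yKn n : y n <= K ^+ n * M.
  elim: n => [|n IH]; first by rewrite expr0 mul1r.
  by rewrite exprS -mulrA (le_trans (yK n))// ler_wpM2l.
(* Otherwise [r] contractions, starting from [y m.+1 <= K ^+ m.+1 * M], would bring the sequence
   below [c]. *)
have [n0 /andP[mn0 n0r] yn0] : exists2 n0, (m <= n0 <= m.+1 + r)%N & y n0 <= c.
  apply: contrapT => noN.
  have big n : (m <= n <= m.+1 + r)%N -> c < y n.
    by move=> nmr; rewrite ltNge; apply/negP => ync; apply: noN; exists n.
  have ytr i : (i <= r)%N -> y (m.+1 + i)%N <= t ^+ i * y m.+1.
    elim: i => [|i IH ir]; first by rewrite addn0 expr0 mul1r.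
    rewrite exprS -mulrA addnS (le_trans (yt (m + i)%N _ _))//.
    - exact: leq_addr.
    - by apply: big; lia.
    - by rewrite -addSn ler_wpM2l// IH// ltnW.
  have := big (m.+1 + r)%N; rewrite leqnn andbT; move=> /(_ ltac:(lia)).
  rewrite ltNge (le_trans (ytr r (leqnn r)))//.
  by rewrite (le_trans _ rc)// ler_wpM2l// exprn_ge0.
have c0 : 0 <= c by exact: le_trans (y0 n0) yn0.
have cK : c <= K ^+ 2 * c by rewrite ler_peMl// exprn_ege1.
have KcK : K * c <= K ^+ 2 * c.
  by rewrite expr2 -mulrA ler_wpM2l// ler_peMl.
(* Two consecutive terms are carried along, since the test on one term controls the passage from the
   next term to the one after it. *)
have inv j : y (n0 + j)%N <= K ^+ 2 * c /\ y (n0 + j).+1 <= K ^+ 2 * c.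
  elim: j => [|j [IH1 IH2]].
    rewrite addn0; split; first exact: le_trans yn0 cK.
    by apply: (le_trans (yK _)); apply: le_trans KcK; rewrite ler_wpM2l.
  rewrite addnS; split=> //; have [yc|cy] := leP (y (n0 + j)%N) c.
    by rewrite (le_trans (yK _))// expr2 -mulrA ler_wpM2l// (le_trans (yK _))// ler_wpM2l.
  have := yt _ (leq_trans mn0 (leq_addr _ _)) cy.
  by have := y0 (n0 + j).+1; nra.
move=> n nr; have [+ _] := inv (n - n0)%N.
by rewrite subnKC// (leq_trans n0r).
Qed.

(** * Energy dynamics of the BB1 iteration and their uniform decay *)

(* [e n i] is the energy of the gradient [g_n] in the eigenspace of [lam i],
   [al n] is the step from [g_n] to [g_(n+1)]. The value [al n = 0] is allowed
   because [bb1_step] is [0 / 0 = 0] at a zero gradient. *)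
Definition bb1_energies (R : realType) (N : nat) (lam : nat -> R) (a : R)
    (e : nat -> nat -> R) (al : nat -> R) : Prop :=
  [/\ forall n i, 0 <= e n i,
      forall n, 0 <= al n <= a^-1,
      forall n i, e n.+1 i = (1 - al n * lam i) ^+ 2 * e n i &
      forall n, al n.+1 =
        (\sum_(i < N) e n i) / (\sum_(i < N) lam i * e n i)].

(** The recurrences are autonomous and [al 0] is constrained only in its range, so a bound from the
    start of every such system holds on every window. *)
Lemma bb1_energies_shift (R : realType) (N : nat) (lam : nat -> R) (a : R)
    (e : nat -> nat -> R) (al : nat -> R) (k : nat) :
  bb1_energies N lam a e al ->
  bb1_energies N lam a (fun n => e (k + n)%N) (fun n => al (k + n)%N).
Proof.
by case=> e0 al0 eS alS; split=> *; rewrite ?addnS.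
Qed.

(** With [t = al n * lam i] in [[0, b / a]], one has [(1 - t)^2 <= 1 + t^2 <= 1 + (b / a)^2]. *)
Lemma energy_growth (R : realType) (N : nat) (lam : nat -> R) (a b : R)
    (e : nat -> nat -> R) (al : nat -> R) (n i : nat) :
  0 < a -> a <= lam i <= b -> bb1_energies N lam a e al ->
  e n.+1 i <= (1 + (b / a) ^+ 2) * e n i.
Proof.
move=> a0 /andP[ai ib] [e0 al0 eS _]; rewrite eS ler_wpM2r//.
have /andP[aln alna] := al0 n.
have t0 : 0 <= al n * lam i by rewrite mulr_ge0// (le_trans (ltW a0)).
have : al n * lam i <= b / a.
  by rewrite mulrC ler_pM// (le_trans (ltW a0)).
set t := _ * _ in t0 *; nra.
Qed.

(* The hypotheses force [a / b <= al n.+1 * lam l <= 3 / 2]. *)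
Lemma energy_contraction (R : realType) (N : nat) (lam : nat -> R) (a b c : R)
    (e : nat -> nat -> R) (al : nat -> R) (n l : nat) :
  0 < a -> (forall i, (i < N)%N -> a <= lam i <= b) ->
  (forall i j, (i <= j < N)%N -> lam i <= lam j) -> (l < N)%N ->
  bb1_energies N lam a e al ->
  \sum_(i < l) e n i <= c -> 2 * c < e n l ->
  e n.+2 l <= (1 - a / b / 2) * e n.+1 l.
Proof.
move=> a0 lamab lam_mono lN [e0 al0 eS alS] lowc cl.
have /andP[al_ lb] := lamab _ lN.
have b0 : 0 < b by lra.
rewrite eS ler_wpM2r//.
have sumsplit (F : nat -> R) :
    \sum_(i < N) F i = \sum_(i < l) F i + \sum_(l <= i < N) F i.
  by rewrite -!(big_mkord xpredT F) (big_cat_nat (n := l))//= ltnW.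
set A := \sum_(i < l) e n i in lowc.
set B := \sum_(l <= i < N) e n i.
have A0 : 0 <= A by apply: sumr_ge0.
have elB : e n l <= B.
  by rewrite /B big_ltn// lerDl; apply: sumr_ge0.
set Q := \sum_(i < N) lam i * e n i.
have QB : lam l * B <= Q.
  rewrite /Q (sumsplit (fun i => lam i * e n i)).
  rewrite -[X in X <= _]add0r lerD//.
    apply: sumr_ge0 => i _; rewrite mulr_ge0//.
    have /andP[+ _] := lamab i (ltn_trans (ltn_ord i) lN); lra.
  rewrite /B mulr_sumr big_nat_cond [X in _ <= X]big_nat_cond.
  apply: ler_sum => i /andP[/andP[li iN] _].
  by rewrite ler_wpM2r// lam_mono// li.
have Qb : Q <= b * (A + B).
  rewrite /A /B -(sumsplit (fun i => e n i)) mulr_sumr; apply: ler_sum => i _.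
  by rewrite ler_wpM2r//; have /andP[] := lamab i (ltn_ord i).
have B0 : 0 < B by lra.
have Q0 : 0 < Q by apply: lt_le_trans QB; rewrite mulr_gt0//; lra.
have S0 : 0 < A + B by lra.
have alE : al n.+1 = (A + B) / Q.
  by rewrite alS (sumsplit (fun i => e n i)).
(* Here [A <= c < e n l / 2 <= B / 2], so [A + B <= 3 / 2 * B], while [Q >= lam l * B]. *)
have hi : al n.+1 * lam l <= 3 / 2.
  rewrite alE mulrAC ler_pdivrMr//; nra.
have lo : a / b <= al n.+1 * lam l.
  rewrite alE [leRHS]mulrAC ler_pdivlMr// mulrAC ler_pdivrMr//.
  apply: (le_trans (ler_wpM2l (ltW a0) Qb)).
  have -> : (A + B) * lam l * b = lam l * (b * (A + B)) by ring.
  by rewrite ler_wpM2r// mulr_ge0// ltW.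
have ab0 : 0 <= a / b by rewrite divr_ge0// ltW.
(* Since [u <= t <= 3 / 2], one has [(1 - t)^2 = 1 - t (2 - t) <= 1 - t / 2 <= 1 - u / 2]. *)
move: lo hi; set t := _ * lam l; set u := a / b in ab0 *; nra.
Qed.

(** Induction on [l]: once the components below [l] are small, component [l] contracts whenever it
    dominates them, so [eventually_le] makes it small too. The delay [m] is chosen before [e] and
    [al], which makes the final rate uniform. *)
Lemma low_energy_small (R : realType) (N : nat) (lam : nat -> R) (a b : R) :
  0 < a -> (forall i, (i < N)%N -> a <= lam i <= b) ->
  (forall i j, (i <= j < N)%N -> lam i <= lam j) ->
  forall l, (l <= N)%N -> forall eps, 0 < eps -> exists m : nat,
  forall e al, bb1_energies N lam a e al -> forall n, (m <= n)%N ->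
  \sum_(i < l) e n i <= eps * \sum_(i < N) e 0%N i.
Proof.
move=> a0 lamab lam_mono; elim=> [_ eps eps0|l IH lN eps eps0].
  exists 0%N => e al [e0 _ _ _] n _; rewrite big_ord0.
  by apply: mulr_ge0; [exact: ltW | apply: sumr_ge0].
set K : R := 1 + (b / a) ^+ 2.
have K1 : 1 <= K by rewrite lerDl sqr_ge0.
have K0 : 0 < K by lra.
have D0 : 0 < 1 + 2 * K ^+ 2 by have := sqr_ge0 K; lra.
(* Chosen so that [del] for the lower components plus [2 * K ^+ 2 * del] for component [l] is
   exactly [eps]. *)
pose del := eps / (1 + 2 * K ^+ 2).
have del0 : 0 < del by rewrite divr_gt0.
have [m mP] := IH (ltnW lN) del del0.
have /andP[al_ lb] := lamab _ lN.
have ab : 0 < a / b <= 1.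
  by rewrite divr_gt0 ?ler_pdivrMr ?mul1r; lra.
(* Enough contractions to offset the possible growth by [K ^+ m.+1] during the waiting time. *)
have [r rP] : exists r, (1 - a / b / 2) ^+ r <= 2 * del / K ^+ m.+1.
  by apply: exists_expr_le; [lra | rewrite divr_gt0 ?exprn_gt0//; lra].
exists (m.+1 + r)%N => e al He n nr; have [e0 al0 eS alS] := He.
set E := \sum_(i < N) e 0%N i.
have E0 : 0 <= E by apply: sumr_ge0.
have low j : (m <= j)%N -> \sum_(i < l) e j i <= del * E by exact: mP He j.
have top : e n l <= K ^+ 2 * (2 * (del * E)).
  apply: (@eventually_le _ K (1 - a / b / 2) (2 * (del * E)) E m r
    (fun n => e n l)) => //.
  - lra.
  - rewrite mulrA [X in _ <= X]mulrA [2 * _]mulrC ler_wpM2r//.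
    by move: rP; rewrite ler_pdivlMr ?exprn_gt0// [del * 2]mulrC.
  - by rewrite /E (bigD1 (Ordinal lN))//= lerDl; apply: sumr_ge0.
  - by move=> j; apply: energy_growth He => //; exact: lamab.
  - by move=> j mj cj; apply: energy_contraction He (low j mj) cj.
have mn : (m <= n)%N := leq_trans (leq_trans (leqnSn m) (leq_addr r _)) nr.
rewrite big_ord_recr /=; apply: (le_trans (lerD (low n mn) top)).
have -> : eps = del * (1 + 2 * K ^+ 2) by rewrite /del divfK// gt_eqF.
by lra.
Qed.

Lemma sqrtr_le_mul (R : realType) (c A B : R) :
  0 <= c -> A <= c ^+ 2 * B -> Num.sqrt A <= c * Num.sqrt B.
Proof.
move=> c0 AB; rewrite -[c in leRHS](ger0_norm c0) -sqrtr_sqr -sqrtrM ?sqr_ge0//.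
exact: ler_wsqrtr.
Qed.

(** Quartering the energy halves the norm [G] over every window of length [m]. Growth within a
    window is absorbed in [C]. *)
Lemma energy_decay (R : realType) (N : nat) (lam : nat -> R) (a b : R) :
  0 < a -> (forall i, (i < N)%N -> a <= lam i <= b) ->
  (forall i j, (i <= j < N)%N -> lam i <= lam j) ->
  exists C rho : R, [/\ 0 <= C, 0 < rho < 1 &
  forall e al, bb1_energies N lam a e al -> forall k : nat,
    Num.sqrt (\sum_(i < N) e k i) <=
      C * rho ^+ k * Num.sqrt (\sum_(i < N) e 0%N i)].
Proof.
move=> a0 lamab lam_mono.
have [m0 m0P] := low_energy_small a0 lamab lam_mono (leqnn N) (eps := 4^-1)
  ltac:(by rewrite invr_gt0).
(* The successor makes the window length positive. *)
pose m := m0.+1; pose K : R := 1 + (b / a) ^+ 2.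
have K1 : 1 <= K by rewrite lerDl sqr_ge0.
have m1 : 1 <= m%:R :> R by rewrite ler1n.
(* With [rho = 1 - 1 / (2 m)], Bernoulli's inequality gives [rho ^+ m >= 1 / 2], without extracting
   an [m]-th root. *)
pose h : R := (2 * m%:R)^-1; pose rho : R := 1 - h.
have hP : 0 < h <= 2^-1.
  by rewrite /h invr_gt0 lef_pV2 ?posrE; lra.
have rho01 : 0 < rho < 1 by rewrite /rho; lra.
have /andP[rho0 rho1] := rho01.
have rhom : 2^-1 <= rho ^+ m.
  have bern j : 1 - j%:R * h <= rho ^+ j.
    elim: j => [|j IHj]; first by rewrite mul0r subr0 expr0.
    have := exprn_ile1 j (ltW rho0) (ltW rho1); rewrite exprS /rho -natr1; nra.
  apply: le_trans (bern m); rewrite /h invfM mulrCA divff ?mulr1; lra.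
(* For [k < m], [K ^+ m] bounds the growth and the factor 2 compensates [rho ^+ k >= 1 / 2]. *)
exists (2 * K ^+ m), rho; split=> //; first by rewrite mulr_ge0// exprn_ge0//; lra.
move=> e al He; pose G k := Num.sqrt (\sum_(i < N) e k i).
have [e0 _ _ _] := He.
have E0 k : 0 <= \sum_(i < N) e k i by apply: sumr_ge0.
have G0 k : 0 <= G k by exact: sqrtr_ge0.
have GK k : G k.+1 <= K * G k.
  apply: sqrtr_le_mul; first by lra.
  rewrite mulr_sumr; apply: ler_sum => i _.
  apply: le_trans (energy_growth k a0 (lamab i (ltn_ord i)) He) _.
  by rewrite ler_wpM2r// -/K; nra.
have Gm k : G (k + m)%N <= 2^-1 * G k.
  apply: sqrtr_le_mul; first by rewrite invr_ge0.
  have := m0P _ _ (bb1_energies_shift k He) m (leqnSn m0).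
  by rewrite addn0 (_ : 4^-1 = 2^-1 ^+ 2 :> R)//; lra.
have GKn k : G k <= K ^+ k * G 0%N.
  elim: k => [|k IHk]; first by rewrite expr0 mul1r.
  by rewrite exprS -mulrA (le_trans (GK k))// ler_wpM2l//; lra.
have half : 1 <= 2 * rho ^+ m by lra.
elim/ltn_ind=> k IHk; rewrite -/(G k) -/(G 0%N); have [km|mk] := ltnP k m.
  apply: (le_trans (GKn k)); rewrite ler_wpM2r//.
  have KK : K ^+ k <= K ^+ m by rewrite ler_weXn2l// ltnW.
  have rr : rho ^+ m <= rho ^+ k by rewrite ler_wiXn2l ?(ltW rho0) ?(ltW rho1)// ltnW.
  by have := exprn_ge0 m (le_trans ler01 K1); nra.
have kmk : (k - m < k)%N by rewrite ltn_subrL /= (leq_trans _ mk).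
have := IHk _ kmk; rewrite -/(G _) -/(G 0%N) => IH.
have := Gm (k - m)%N; rewrite subnK// => GG.
have -> : rho ^+ k = rho ^+ m * rho ^+ (k - m) by rewrite -exprD subnKC.
rewrite mulrCA -mulrA; apply: (le_trans GG).
by rewrite ler_pM ?invr_ge0.
Qed.

(** * Positive definite quadratics: gradient and objective gap *)

Lemma spd_unitmx (R : realType) (d : nat) (H : 'M[R]_d) : spd H -> H \in unitmx.
Proof.
case=> Hsym Hpos; rewrite -row_free_unit; apply: inj_row_free => v vH.
apply: trmx_inj; rewrite trmx0; apply/eqP; apply/negP => /negP /Hpos.
by rewrite /dot -{1}Hsym -trmx_mul vH trmx0 mulmx0 mxE ltxx.
Qed.

Lemma spd_eigen_gt0 (R : realType) (d : nat) (H : 'M[R]_d) (l : R)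
    (u : 'cV[R]_d) : spd H -> H *m u = l *: u -> u != 0 -> 0 < l.
Proof.
move=> [_ Hpos] Hu u0; have := Hpos u u0; rewrite Hu dotZr => lu.
rewrite ltNge; apply/negP => l0.
by have := mulr_le0_ge0 l0 (dot_ge0 u); rewrite leNgt lu.
Qed.

Lemma grad_step (R : realType) (d : nat) (H : 'M[R]_d) (q y : 'cV[R]_d)
    (t : R) :
  grad H q (y - t *: grad H q y) = grad H q y - t *: (H *m grad H q y).
Proof. by rewrite {1}/grad addrAC mulmxBr -scalemxAr. Qed.

(** Completing the square, after the substitution [q = H *m xstar H q]. *)
Lemma quad_gap (R : realType) (d : nat) (H : 'M[R]_d) (q y : 'cV[R]_d) :
  spd H -> quad H q y - quad H q (xstar H q) =
    2^-1 * dot (y - xstar H q) (grad H q y).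
Proof.
move=> Hspd; have [Hsym _] := Hspd.
have qE : q = H *m xstar H q by rewrite /xstar mulKVmx// spd_unitmx.
rewrite /quad /grad; set p := xstar H q in qE *; clearbody p; rewrite qE.
rewrite mulmxBr dotBr ![dot (y - p) _]dotC !dotBr.
have sw u v : dot (H *m u) v = dot v (H *m u) by exact: dotC.
have swyp : dot p (H *m y) = dot y (H *m p) by rewrite dot_mulmx// sw.
rewrite !sw swyp.
by field.
Qed.

(** * Orthogonal combinations of eigenvectors and ordered finite spectra *)

Lemma dot_comb (R : realType) (d N : nat) (w : nat -> 'cV[R]_d)
    (c c' : nat -> R) :
  (forall i j, (i < N)%N -> (j < N)%N -> i != j -> dot (w i) (w j) = 0) ->
  dot (\sum_(i < N) c i *: w i) (\sum_(i < N) c' i *: w i) =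
  \sum_(i < N) c i * c' i * dot (w i) (w i).
Proof.
move=> worth; rewrite dot_sumr; apply: eq_bigr => i _.
rewrite dotC dot_sumr (bigD1 i)//= big1 ?addr0 => [|j ji].
  by rewrite dotZl dotZr; ring.
by rewrite dotZl dotZr worth ?mulr0// eq_sym.
Qed.

Lemma mulmx_comb (R : realType) (d N : nat) (H : 'M[R]_d) (w : nat -> 'cV[R]_d)
    (lam c : nat -> R) :
  (forall i, (i < N)%N -> H *m w i = lam i *: w i) ->
  H *m (\sum_(i < N) c i *: w i) = \sum_(i < N) (lam i * c i) *: w i.
Proof.
move=> Hw; rewrite mulmx_sumr; apply: eq_bigr => i _.
by rewrite -scalemxAr Hw// scalerA mulrC.
Qed.

(** Sorting lets the induction from the lowest eigenvalue run over indices. *)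
Lemma finite_set_sorted (R : realType) (A : set R) :
  finite_set A -> exists s : seq R,
    [/\ uniq s, sorted <=%R s & A = [set` s]].
Proof.
move=> /finite_seqP[s ->]; exists (sort <=%R (undup s)); split.
- by rewrite sort_uniq undup_uniq.
- exact: sort_le_sorted.
- by apply/seteqP; split=> l /=; rewrite mem_sort mem_undup.
Qed.

Lemma pos_seq_bounds (R : realType) (s : seq R) :
  sorted <=%R s -> all (fun l => 0 < l) s -> exists a b : R,
    0 < a /\ forall i, (i < size s)%N -> a <= s`_i <= b.
Proof.
case: s => [|l s] ss s0; first by exists 1, 1.
exists l, (last l s); split; first by have /andP[] := s0.
move=> i iS; have homo := sorted_leq_nth le_trans le_refl 0 ss.
apply/andP; split; first by apply: (homo 0%N i).
by rewrite (last_nth 0); apply: (homo i (size s)); rewrite ?inE.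
Qed.


(** * From gradients to energies, then to errors and objective gaps *)

Theorem theorem6p3 (R : realType) (Lam : set R) (Lam_fin : finite_set Lam) :
  exists C rho : R,
    0 < rho < 1 /\
    forall (d : nat) (H : 'M[R]_d) (q : 'cV[R]_d) (x : int -> 'cV[R]_d),
      spd H ->
      bb1_tail H q x ->
      spectral_set H (grad H q (x (-1))) = Lam ->
      [/\ forall k : nat,
            enorm (grad H q (x k%:Z)) <= C * rho ^+ k * enorm (grad H q (x 0)),
          exists C' : R, forall k : nat,
            enorm (x k%:Z - xstar H q) <= C' * rho ^+ k &
          exists C'' : R, forall k : nat,
            quad H q (x k%:Z) - quad H q (xstar H q) <= C'' * rho ^+ (2 * k)].
Proof.
have [s [us ss ->]] := finite_set_sorted Lam_fin.
(* If some element is not positive, no positive definite [H] has this spectral set and any constants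
   will do. *)
have [spos|/allPn[l ls l0]] := boolP (all (fun l => 0 < l) s); last first.
  exists 0, 2^-1; split; first by lra.
  move=> d H q x Hspd _ Hs.
  have : [set` s] l by []; rewrite -Hs => -[_ Pl].
  by have := spd_eigen_gt0 Hspd (eigproj_eigen _ _ Hspd.1) Pl; rewrite (negPf l0).
have [a [b [a0 sab]]] := pos_seq_bounds ss spos.
have smono i j : (i <= j < size s)%N -> s`_i <= s`_j.
  move=> /andP[ij js]; apply: (sorted_leq_nth le_trans le_refl 0 ss) => //.
  by rewrite inE (leq_ltn_trans ij).
have [C [rho [C0 rho01 decay]]] := energy_decay a0 sab smono.
exists C, rho; split=> // d H q x Hspd [[ahat x0E] _ _ xE] Hs.
have [Hsym _] := Hspd.
set N := size s in sab smono decay *.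
(* Indices are shifted by one: [gam n] is the gradient at index [n - 1], and [al 0] is the warm-up
   step. *)
pose gam n := grad H q (x (n%:Z - 1)).
pose al n := if n is n'.+1 then bb1_step H (gam n') else ahat.
have intB1 (k : nat) : k.+1%:Z - 1 = k%:Z by rewrite intS addrAC subrr add0r.
have gamS n : gam n.+1 = gam n - al n *: (H *m gam n).
  rewrite -grad_step /gam; congr (grad H q _).
  case: n => [|n]; first by rewrite /= x0E.
  by rewrite !intB1 /= -[n.+1]addn1 PoszD xE.
have gam0 : spectral_set H (gam 0%N) = [set` s] by rewrite -Hs /gam sub0r.
pose w i := eigproj H s`_i *m gam 0%N.
have Hw i : H *m w i = s`_i *: w i by exact: eigproj_eigen.
have worth i j : (i < N)%N -> (j < N)%N -> i != j -> dot (w i) (w j) = 0.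
  by move=> iN jN ij; apply: (dot_eigen0 Hsym (Hw i) (Hw j)); rewrite nth_uniq.
pose c n i := \prod_(j < n) (1 - al j * s`_i).
have gamE n : gam n = \sum_(i < N) c n i *: w i.
  elim: n => [|n IHn].
    rewrite [LHS](spectral_decomposition Hsym us gam0) (big_nth 0) big_mkord.
    by apply: eq_bigr => i _; rewrite /c big_ord0 scale1r.
  rewrite gamS IHn (mulmx_comb _ (fun i _ => Hw i)) scaler_sumr -sumrB.
  apply: eq_bigr => i _; rewrite scalerA -scalerBl /c big_ord_recr /=.
  by congr (_ *: _); ring.
(* Energies start at the gradient of [x 0], because the warm-up step [ahat] need not lie in
   [[0, a^-1]]. *)
pose e n i := c n.+1 i ^+ 2 * dot (w i) (w i).
have c2w0 n i : 0 <= c n i ^+ 2 * dot (w i) (w i).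
  by rewrite mulr_ge0 ?sqr_ge0 ?dot_ge0.
have dot_gam n :
    dot (gam n) (gam n) = \sum_(i < N) c n i ^+ 2 * dot (w i) (w i).
  by rewrite gamE dot_comb.
have dot_Hgam n : dot (gam n) (H *m gam n) =
    \sum_(i < N) s`_i * (c n i ^+ 2 * dot (w i) (w i)).
  rewrite gamE (mulmx_comb _ (fun i _ => Hw i)).
  rewrite (dot_comb _ (fun i => s`_i * c n i) worth).
  by apply: eq_bigr => i _; ring.
have energies : bb1_energies N (fun i => s`_i) a e (fun n => al n.+1).
  split.
  - by move=> n i; exact: c2w0.
  - move=> n /=; rewrite /bb1_step.
    have aQ : a * dot (gam n) (gam n) <= dot (gam n) (H *m gam n).
      rewrite dot_gam dot_Hgam mulr_sumr; apply: ler_sum => i _.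
      rewrite ler_wpM2r ?c2w0//.
      by have /andP[] := sab i (ltn_ord i).
    have S0 := dot_ge0 (gam n).
    (* If the denominator is zero, division by zero returns the step 0, which is in range. *)
    have [Q0|Q0|->] := ltrgt0P (dot (gam n) (H *m gam n)).
    + by rewrite divr_ge0 ?(ltW Q0)//= ler_pdivrMr// ler_pdivlMl.
    + by have := mulr_ge0 (ltW a0) S0; lra.
    + by rewrite invr0 mulr0 lexx invr_ge0 ltW.
  - by move=> n i; rewrite /e /c big_ord_recr /=; ring.
  - by move=> n; rewrite /= /bb1_step dot_gam dot_Hgam.
have gk (k : nat) : grad H q (x k%:Z) = gam k.+1.
  by rewrite /gam intB1.
have enormE k : enorm (gam k.+1) = Num.sqrt (\sum_(i < N) e k i).
  by rewrite /enorm dot_gam.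
have bound (k : nat) :
    enorm (grad H q (x k%:Z)) <= C * rho ^+ k * enorm (grad H q (x 0)).
  by rewrite (gk 0%N) gk !enormE; exact: decay energies k.
set G0 := enorm (grad H q (x 0)) in bound *.
(* The error is [H^-1] applied to the gradient, so each coefficient is divided by its eigenvalue. *)
have zE (k : nat) :
    x k%:Z - xstar H q = \sum_(i < N) ((s`_i)^-1 * c k.+1 i) *: w i.
  apply: (can_inj (mulKmx (spd_unitmx Hspd))).
  rewrite -/(grad H q (x k%:Z)) gk gamE.
  rewrite (mulmx_comb (fun i => (s`_i)^-1 * c k.+1 i) (fun i _ => Hw i)).
  apply: eq_bigr => i _; rewrite mulVKf// gt_eqF//.
  by have /andP[+ _] := sab i (ltn_ord i); lra.
have sV (i : 'I_N) : 0 <= (s`_i)^-1 <= a^-1.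
  have /andP[ai _] := sab i (ltn_ord i); have si := lt_le_trans a0 ai.
  by rewrite invr_ge0 ltW//= lef_pV2.
split=> //.
- exists (a^-1 * (C * G0)) => k.
  have zg : enorm (x k%:Z - xstar H q) <= a^-1 * enorm (grad H q (x k%:Z)).
    apply: sqrtr_le_mul; first by rewrite invr_ge0 ltW.
    rewrite gk dot_gam zE mulr_sumr.
    rewrite (dot_comb (fun i => (s`_i)^-1 * c k.+1 i)
      (fun i => (s`_i)^-1 * c k.+1 i) worth).
    apply: ler_sum => i _.
    rewrite [leRHS]mulrA ler_wpM2r ?dot_ge0// -expr2 exprMn ler_wpM2r ?sqr_ge0//.
    by have /andP[? ?] := sV i; rewrite lerXn2r ?nnegrE// invr_ge0 ltW.
  apply: (le_trans zg); rewrite -[leRHS]mulrA ler_wpM2l ?invr_ge0 ?(ltW a0)//.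
  by rewrite [leRHS]mulrAC.
- exists (2^-1 * a^-1 * (C * G0) ^+ 2) => k; rewrite quad_gap//.
  rewrite -[leRHS]mulrA -[leRHS]mulrA ler_wpM2l ?invr_ge0//.
  have -> : (C * G0) ^+ 2 * rho ^+ (2 * k) = (C * rho ^+ k * G0) ^+ 2.
    by rewrite mulnC exprM; ring.
  have gsq : enorm (grad H q (x k%:Z)) ^+ 2 <= (C * rho ^+ k * G0) ^+ 2.
    by rewrite lerXn2r ?nnegrE ?sqrtr_ge0// (le_trans _ (bound k))// sqrtr_ge0.
  apply: (@le_trans _ _ (a^-1 * enorm (grad H q (x k%:Z)) ^+ 2)); last first.
    by rewrite ler_wpM2l// invr_ge0 ltW.
  rewrite sqr_sqrtr ?dot_ge0// gk zE dot_gam gamE mulr_sumr.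
  rewrite (dot_comb (fun i => (s`_i)^-1 * c k.+1 i) _ worth).
  apply: ler_sum => i _; rewrite [leRHS]mulrA ler_wpM2r ?dot_ge0//.
  rewrite -mulrA -expr2 ler_wpM2r ?sqr_ge0//.
  by have /andP[] := sV i.
Qed.
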